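(* Let $1<p<\infty$ and $1<q\le p$. Let $H:\mathbb{R}^N\to[0,+\infty)$ be a positively $p$-homogeneous convex function. Let $\Omega\subset\mathbb{R}^N$ be an open set. For every pair of differentiable functions $u_0,u_1:\Omega\to[0,+\infty)$, define \[ \sigma_t(x)=\Big[(1-t)\, u_0(x)^q+t\, u_1(x)^q\Big]^\frac{1}{q},\qquad t\in[0,1],\ x\in\Omega. \] Then \[ H(\nabla \sigma_t)\le (1-t)\,H(\nabla u_0)+t\, H(\nabla u_1)\quad\text{pointwise in }\Omega,\text{ for every } t\in[0,1]. \]
   Context: $H$ is positively $p$-homogeneous if $H(\lambda z)=\lambda^p H(z)$ for all $z\in\mathbb{R}^N$ and all real $\lambda\ge 0$ ($H$ is not assumed to be even). *)

(* Defs.v *)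
From HB Require Import structures.
From mathcomp Require Import all_boot all_order all_algebra.
From mathcomp Require Import all_classical all_reals all_analysis.

Set Implicit Arguments.
Unset Strict Implicit.
Unset Printing Implicit Defensive.

Import Order.TTheory GRing.Theory Num.Theory.
Import numFieldNormedType.Exports.
Local Open Scope classical_set_scope.
Local Open Scope ring_scope.

Definition positively_homogeneous (R : realType) (N : nat) (p : R)
    (H : 'rV[R]_N -> R) : Prop :=
  forall (lambda : R) (z : 'rV[R]_N),
    0 <= lambda -> H (lambda *: z) = lambda `^ p * H z.

(* 'D_v is total, so this is the gradient only where f is differentiable. *)
Definition gradient (R : realType) (N : nat) (f : 'rV[R]_N -> R)
    (x : 'rV[R]_N) : 'rV[R]_N :=
  \row_(i < N) 'D_(delta_mx 0 i) f x.

(* Functions on an open set Omega are represented by total functions; the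
   values outside Omega affect neither differentiability nor the gradient at
   points of Omega. *)
Definition sigma (R : realType) (N : nat) (q : R) (u0 u1 : 'rV[R]_N -> R)
    (t : R) (x : 'rV[R]_N) : R :=
  ((1 - t) * u0 x `^ q + t * u1 x `^ q) `^ q^-1.

(* Main.v *)
Require Import Defs.
From HB Require Import structures.
From mathcomp Require Import all_boot all_order all_algebra.
From mathcomp Require Import all_classical all_reals all_analysis.
From mathcomp Require Import ring lra.

Set Implicit Arguments.
Unset Strict Implicit.
Unset Printing Implicit Defensive.

Import Order.TTheory GRing.Theory Num.Theory.
Import numFieldNormedType.Exports.
Local Open Scope classical_set_scope.
Local Open Scope ring_scope.

(** Where [sigma > 0], put [a_i = u_i / sigma], so that
    [(1 - t) a_0^q + t a_1^q = 1] and
    [grad sigma = (1 - t) a_0^(q-1) grad u_0 + t a_1^(q-1) grad u_1].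
    With [b_i = a_i^((q-1)/(p-1))] and [S = (1 - t) b_0^p + t b_1^p], this
    vector is [S] times a convex combination of the [b_i^(-1) grad u_i], so
    convexity and homogeneity give
    [H (grad sigma) <= S^(p-1) ((1 - t) H (grad u_0) + t H (grad u_1))].
    Finally [S <= 1] by comparing power means, as [(q-1)p/(p-1) <= q] is exactly
    [q <= p].
    Where [sigma = 0], sigma is squeezed between [0] and a nonnegative
    differentiable function vanishing at the point, so its gradient is [0]. *)

(** * Inequalities from powers, convexity and homogeneity *)

(** Split [a^q = a * a^(q-1)], and likewise for [b] and [a + b]; both [a^(q-1)] and [b^(q-1)] are at
    most [(a + b)^(q-1)]. *)
Lemma powR_superadditive (R : realType) (q a b : R) :
  1 <= q -> 0 <= a -> 0 <= b -> a `^ q + b `^ q <= (a + b) `^ q.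
Proof.
move=> q1 a0 b0; have q0 : 0 < q by apply: lt_le_trans q1.
rewrite -(mulr_powRB1 a0 q0) -(mulr_powRB1 b0 q0).
rewrite -(mulr_powRB1 (addr_ge0 a0 b0) q0) mulrDl.
by apply: lerD; rewrite ler_wpM2l// ge0_ler_powR ?nnegrE ?subr_ge0 ?addr_ge0//
  ?lerDl ?lerDr.
Qed.

Lemma convexE (R : realType) (V : lmodType R) (H : V -> R) (w : R) (x y : V) :
  convex_function [set: convex_lmodType V] H -> 0 <= w -> w <= 1 ->
  H (w *: x + (1 - w) *: y) <= w * H x + (1 - w) * H y.
Proof.
move=> cH w0 w1.
by apply: (cH (Itv01 w0 w1)); rewrite inE.
Qed.

Lemma convex_powRE (R : realType) (r w x y : R) :
  1 <= r -> 0 <= w -> w <= 1 -> 0 <= x -> 0 <= y ->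
  (w * x + (1 - w) * y) `^ r <= w * x `^ r + (1 - w) * y `^ r.
Proof.
move=> r1 w0 w1 x0 y0.
by apply: (convex_powR r1 (Itv01 w0 w1)); rewrite inE/= in_itv/= andbT.
Qed.

Lemma convex_homogeneous_le (R : realType) (N : nat) (p : R)
    (H : 'rV[R]_N -> R) (w b0 b1 : R) (g0 g1 : 'rV[R]_N) :
  1 < p -> (forall z, 0 <= H z) -> positively_homogeneous p H ->
  convex_function [set: convex_lmodType 'rV[R]_N] H ->
  0 <= w -> w <= 1 -> 0 <= b0 -> 0 <= b1 ->
  let S := w * b0 `^ p + (1 - w) * b1 `^ p in
  0 < S -> S <= 1 ->
  H ((w * b0 `^ (p - 1)) *: g0 + ((1 - w) * b1 `^ (p - 1)) *: g1) <=
    w * H g0 + (1 - w) * H g1.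
Proof.
move=> p1 H0 homH cH w0 w1 b00 b10 S Sgt0 S1.
have p0 : 0 < p by apply: lt_trans p1.
have S0 := ltW Sgt0; have Sn0 : S != 0 by rewrite gt_eqF.
pose m := w * b0 `^ p / S.
have m0 : 0 <= m by rewrite !mulr_ge0 ?invr_ge0 ?powR_ge0.
have mE : 1 - m = (1 - w) * b1 `^ p / S.
  by rewrite /m -[1](divff Sn0) -mulrBl {1}/S addrAC subrr add0r divff.
have m1 : m <= 1.
  by rewrite -subr_ge0 mE !mulr_ge0 ?invr_ge0 ?powR_ge0 ?subr_ge0.
(* Since [0^-1 = 0] and [p - 1] is nonzero, both sides vanish at [b = 0], so the decomposition [vE]
   covers zero [b0] or [b1] too. *)
have pB b : 0 <= b -> b `^ p / b = b `^ (p - 1).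
  rewrite le0r => /orP[/eqP->|b0'].
    by rewrite invr0 mulr0 powR0// subr_eq0 gt_eqF.
  rewrite -(mulr_powRB1 (ltW b0') p0).
  by rewrite mulrAC divff ?mul1r ?gt_eqF.
have vE : (w * b0 `^ (p - 1)) *: g0 + ((1 - w) * b1 `^ (p - 1)) *: g1 =
    S *: (m *: (b0^-1 *: g0) + (1 - m) *: (b1^-1 *: g1)).
  rewrite mE scalerDr !scalerA -!pB//; congr (_ *: _ + _ *: _).
    by rewrite /m [S * _]mulrC divfK// mulrA.
  by rewrite [S * _]mulrC divfK// mulrA.
(* Homogeneity gives equality for [b > 0]; at [b = 0] the left side is [0] and the right side is
   nonnegative because [H] is. *)
have Hb v b g : 0 <= v -> 0 <= b -> v * b `^ p * H (b^-1 *: g) <= v * H g.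
  move=> v0 b0'; rewrite -mulrA ler_wpM2l//.
  rewrite homH ?invr_ge0// mulrA -powRM ?invr_ge0//.
  have [->|bn0] := eqVneq b 0; first by rewrite mul0r powR0 ?mul0r ?gt_eqF.
  by rewrite divff// powR1 mul1r.
rewrite vE homH//.
(* Homogeneity contributes [S^p] and the weights [m], [1 - m] contribute [1 / S]; the remaining
   factor [S^(p-1)] is at most [1]. *)
apply: (@le_trans _ _ (S `^ p * ((w * H g0 + (1 - w) * H g1) / S))).
  rewrite ler_wpM2l ?powR_ge0//; apply: (le_trans (convexE _ _ cH m0 m1)).
  rewrite mE /m [X in X + _]mulrAC [X in _ + X]mulrAC -mulrDl.
  by rewrite ler_wpM2r ?invr_ge0// lerD ?Hb ?subr_ge0.
rewrite -(@mulr_powRB1 _ S p)//.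
have -> : S * S `^ (p - 1) * ((w * H g0 + (1 - w) * H g1) / S) =
   S `^ (p - 1) * (w * H g0 + (1 - w) * H g1) by field.
rewrite ler_piMl ?addr_ge0 ?mulr_ge0 ?subr_ge0//.
have : S `^ (p - 1) <= 1 `^ (p - 1).
  by apply: ge0_ler_powR; rewrite ?nnegrE// subr_ge0 ltW.
by rewrite powR1.
Qed.
(** If the sum [S] of [r]-th powers were [0], each term would have a zero weight or a zero base, and
    the sum of [q]-th powers would be [0] as well. For the upper bound, convexity of the power
    [q / r >= 1], applied to the [x_i^r], gives [S^(q/r) <= 1]. *)
Lemma power_mean_bounds (R : realType) (q r w x0 x1 : R) :
  0 < r -> r <= q -> 0 <= w -> w <= 1 -> 0 <= x0 -> 0 <= x1 ->
  w * x0 `^ q + (1 - w) * x1 `^ q = 1 ->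
  0 < w * x0 `^ r + (1 - w) * x1 `^ r <= 1.
Proof.
move=> r0 rq w0 w1 x00 x10 E.
have w0' : 0 <= 1 - w by rewrite subr_ge0.
have q0 : 0 < q by apply: lt_le_trans rq.
apply/andP; split.
  rewrite lt0r addr_ge0 ?mulr_ge0 ?powR_ge0// andbT.
  apply/negP; rewrite paddr_eq0 ?mulr_ge0 ?powR_ge0// !mulf_eq0 !powR_eq0.
  rewrite (gt_eqF r0) !andbT => S0; move/eqP: E; apply/negP.
  suff -> : w * x0 `^ q + (1 - w) * x1 `^ q = 0 by rewrite eq_sym oner_eq0.
  apply/eqP; rewrite paddr_eq0 ?mulr_ge0 ?powR_ge0// !mulf_eq0 !powR_eq0.
  by rewrite (gt_eqF q0) !andbT.
have s1 : 1 <= q / r by rewrite ler_pdivlMr// mul1r.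
have := convex_powRE s1 w0 w1 (powR_ge0 x0 r) (powR_ge0 x1 r).
rewrite -!powRrM (mulrC r) divfK ?gt_eqF// E -[X in _ <= X]/1.
set S := _ + _ => Sr; rewrite leNgt; apply/negP => S1.
have : 1 `^ (q / r) < S `^ (q / r).
  apply: gt0_ltr_powR; rewrite ?nnegrE// ?(lt_le_trans ltr01)//.
  by rewrite ltW// (lt_trans ltr01).
by rewrite powR1 ltNge Sr.
Qed.

(** * Differentials at minima, under squeezing, and of powers *)

Section Diff.
Variables (R : realType) (V : normedModType R).
Implicit Types (f g u : V -> R) (x : V).

Lemma differentiable_expansion f x : differentiable f x ->
  forall e, 0 < e -> \forall h \near 0,
    `|f (h + x) - f x - 'd f x h| <= e * `|h|.
Proof.
move=> /diff_locally/eqaddoP fo e e0.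
apply: filterS (fo e e0) => h.
by rewrite -[X in `|X|]/(f (h + x) - (f x + 'd f x h)) opprD addrA.
Qed.

Lemma is_diff0 f x :
  (forall e, 0 < e -> \forall h \near 0, `|f (h + x) - f x| <= e * `|h|) ->
  is_diff x f 0.
Proof.
move=> fo.
have E : f \o shift x = cst (f x) + (\0 : {linear V -> R}) +o_ 0 id.
  apply/eqaddoP => e e0; apply: filterS (fo e e0) => h.
  by rewrite -[X in _ -> `|X| <= _]/(f (h + x) - (f x + 0)) addr0.
have d0 : 'd f x = (\0 : {linear V -> R}) :> (V -> R).
  by apply: diff_unique => //; exact: (@cst_continuous _ _ (0 : R)).
split; last by rewrite d0.
apply/diff_locallyP; rewrite d0; split => //.
exact: (@cst_continuous _ _ (0 : R)).
Qed.

(** The expansion along small positive multiples of [v] shows that the differential is nonnegative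
    at [v]; linearity and the direction [- v] give the reverse sign. *)
Lemma diff_local_min f x : differentiable f x ->
  (\forall y \near x, f x <= f y) -> 'd f x = 0 :> (V -> R).
Proof.
move=> dfx fmin.
have ge0 v : 0 <= 'd f x v.
  apply/ler_addgt0Pl => e e0.
  (* Scaled so that the error in direction [v] is at most [e]; the [+ 1] covers [v = 0]. *)
  have e'0 : 0 < e / (`|v| + 1) by rewrite divr_gt0// ltr_wpDl.
  have key : \forall h \near (0 : V),
    - (e / (`|v| + 1) * `|h|) <= 'd f x h.
    have := differentiable_expansion dfx e'0.
    move: fmin; rewrite (near_shift 0) subr0; apply: filterS2 => h /= fm.
    by rewrite ler_norml => /andP[_]; lra.
  (* A single small [s] suffices: both sides are homogeneous in [s > 0], so it cancels. *)
  have [s s0 /=] : exists2 s : R, 0 < s &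
      - (e / (`|v| + 1) * `|s *: v|) <= 'd f x (s *: v).
    move: key => /nbhs_ballP[d /= d0 dP].
    have s0 : 0 < d / (`|v| + 1) by rewrite divr_gt0// ltr_wpDl.
    exists (d / (`|v| + 1)) => //; apply: dP.
    rewrite -ball_normE /= sub0r normrN normrZ gtr0_norm//.
    by rewrite -mulrA gtr_pMr// mulrC ltr_pdivrMr ?ltr_wpDl// mul1r ltrDl.
  have -> : 'd f x (s *: v) = s * 'd f x v by rewrite linearZ.
  rewrite normrZ gtr0_norm// => key_s.
  have : - (e / (`|v| + 1) * `|v|) <= 'd f x v.
    by rewrite -(ler_pM2l s0) mulrN mulrCA.
  have : e / (`|v| + 1) * `|v| <= e.
    by rewrite -mulrA ger_pMr// mulrC ler_pdivrMr ?ltr_wpDl// mul1r lerDl.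
  by lra.
apply/funext => v; apply/eqP; rewrite eq_le ge0 andbT.
by have := ge0 (- v); rewrite linearN oppr_ge0.
Qed.

(** The point [x] is a local minimum of [g], so [g] has zero differential there and is [o(h)]; [f]
    inherits this bound. *)
Lemma is_diff_squeeze f g x : differentiable g x -> g x = 0 ->
  (\forall y \near x, 0 <= f y <= g y) -> is_diff x f 0.
Proof.
move=> dg gx0 fg.
have fx0 : f x = 0.
  by apply/eqP; rewrite eq_le; move: (nbhs_singleton fg);
    rewrite gx0 => /andP[-> ->].
have dg0 : 'd g x = 0 :> (V -> R).
  apply: diff_local_min => //; apply: filterS fg => y /andP[fy gy].
  by rewrite gx0 (le_trans fy).
apply: is_diff0 => e e0; have := differentiable_expansion dg e0.
move: fg; rewrite (near_shift 0) subr0; apply: filterS2 => h /= /andP[fh gh].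
rewrite dg0 -[(0 : V -> R) h]/(0 : R) gx0 fx0 !subr0 (ger0_norm fh) => gle.
exact: le_trans (le_trans gh (ler_norm _)) gle.
Qed.

Lemma is_diff_powR_gt0 u x (a : R) (du : V -> R) : is_diff x u du -> 0 < u x ->
  is_diff x (fun y => u y `^ a) (fun h => a * u x `^ (a - 1) * du h).
Proof.
move=> dux ux0.
have [/derivable1_diffP dp pE] := is_derive1_powR a ux0.
have pd : is_diff (u x) (@powR R ^~ a) (fun h => h * (a * u x `^ (a - 1))).
  by split => //; rewrite diff1E// derive1E pE.
apply: is_diff_eq; first exact: (is_diff_comp dux pd).
by apply/funext => h /=; rewrite mulrC.
Qed.

(* [s `^ q] is [1] for [s < 0], so the chain rule fails where [u x = 0]; there
   [0 <= u `^ q <= u] near [x]. *)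
Lemma is_diff_powR u x (q : R) (du : V -> R) : 1 < q ->
  is_diff x u du -> (\forall y \near x, 0 <= u y) ->
  is_diff x (fun y => u y `^ q) (fun h => q * u x `^ (q - 1) * du h).
Proof.
move=> q1 dux u0.
have := nbhs_singleton u0; rewrite le0r => /orP[/eqP ux0|/= ux0]; last first.
  exact: is_diff_powR_gt0.
have dx : differentiable u x by [].
have ult1 : \forall y \near x, u y < 1.
  have /(_ [set y | y < 1]) := differentiable_continuous dx.
  by apply; apply: lt_nbhsl; rewrite ux0.
apply: is_diff_eq.
  apply: (is_diff_squeeze dx ux0); apply: filterS2 u0 ult1 => y uy0 uy1.
  rewrite powR_ge0/=.
  move: uy0; rewrite le0r => /orP[/eqP->|uy0].
    by rewrite powR0 ?gt_eqF// (lt_trans ltr01).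
  by rewrite ge1r_powR ?uy0 ?ltW.
(* The announced differential is [0] as well, since [0^(q-1) = 0] for [q > 1]. *)
by apply/funext => h; rewrite ux0 powR0 ?mulr0 ?mul0r// subr_eq0 gt_eqF.
Qed.

End Diff.

(** * Gradients, and the differential of [sigma] *)

Lemma gradientE (R : realType) (N : nat) (f df : 'rV[R]_N -> R) x :
  is_diff x f df -> gradient f x = \row_i df (delta_mx 0 i).
Proof.
by move=> dfx; apply/rowP => i; rewrite !mxE deriveE// diff_val.
Qed.

Section SigmaDiff.
Variables (R : realType) (N : nat) (q t : R).
Variables (u0 u1 : 'rV[R]_N -> R) (x : 'rV[R]_N).
Hypotheses (q1 : 1 < q) (t0 : 0 <= t) (t1 : t <= 1).
Hypotheses (u0_ge0 : \forall y \near x, 0 <= u0 y).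
Hypotheses (u1_ge0 : \forall y \near x, 0 <= u1 y).
Hypotheses (du0 : differentiable u0 x) (du1 : differentiable u1 x).

Let F y := (1 - t) * u0 y `^ q + t * u1 y `^ q.

Let q0 : 0 < q. Proof. exact: lt_trans q1. Qed.

Let t1' : 0 <= 1 - t. Proof. by rewrite subr_ge0. Qed.

(* The dominating function is [(1 - t)^(1/q) u0 + t^(1/q) u1]. *)
Lemma is_diff_sigma_eq0 : F x = 0 -> is_diff x (sigma q u0 u1 t) 0.
Proof.
move=> Fx0.
pose a0 := (1 - t) `^ q^-1; pose a1 := t `^ q^-1.
have aE (a u : R) : 0 <= a -> 0 <= u -> (a `^ q^-1 * u) `^ q = a * u `^ q.
  by move=> a_ge0 u_ge0; rewrite powRM ?powR_ge0// -powRrM mulVf ?gt_eqF//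
    powRr1.
have rootK (a : R) : 0 <= a -> (a `^ q) `^ q^-1 = a.
  by move=> a_ge0; rewrite -powRrM divff ?gt_eqF// powRr1.
have root0 (a u : R) : 0 <= a -> 0 <= u -> a * u `^ q = 0 -> a `^ q^-1 * u = 0.
  move=> a_ge0 u_ge0 au0; rewrite -[LHS]rootK ?mulr_ge0 ?powR_ge0// aE// au0.
  by rewrite powR0 ?invr_eq0 ?gt_eqF.
have u0x := nbhs_singleton u0_ge0; have u1x := nbhs_singleton u1_ge0.
have /andP[/eqP F0 /eqP F1] :
    ((1 - t) * u0 x `^ q == 0) && (t * u1 x `^ q == 0).
  by rewrite -paddr_eq0 ?mulr_ge0 ?powR_ge0//; exact/eqP.
apply: (@is_diff_squeeze _ _ _ (a0 *: u0 + a1 *: u1)).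
- by apply: differentiableD; apply: differentiableZ.
- rewrite -[LHS]/(a0 * u0 x + a1 * u1 x).
  by rewrite /a0 /a1 !root0// addr0.
apply: filterS2 u0_ge0 u1_ge0 => y u0y u1y.
rewrite powR_ge0/= -[leRHS]/(a0 * u0 y + a1 * u1 y).
(* It suffices to compare [q]-th powers: [F y] is the sum of the [q]-th powers of [a0 * u0 y] and
   [a1 * u1 y], so superadditivity applies. *)
rewrite -[leRHS]rootK ?addr_ge0 ?mulr_ge0 ?powR_ge0//.
apply: ge0_ler_powR; rewrite ?nnegrE ?invr_ge0 ?powR_ge0 ?(ltW q0)//.
  by rewrite addr_ge0 ?mulr_ge0 ?powR_ge0.
rewrite -[X in X + _]aE// -[X in _ + X]aE//.
by apply: powR_superadditive; rewrite ?mulr_ge0 ?powR_ge0// ltW.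
Qed.

(** The chain rule for the outer root uses [0 < F x]; one of [u0 x], [u1 x] may still vanish, and
    its [q]-th power is differentiable there because [1 < q]. *)
Lemma is_diff_sigma_gt0 (s := sigma q u0 u1 t x) : 0 < F x ->
  is_diff x (sigma q u0 u1 t)
    (fun h => (1 - t) * (u0 x / s) `^ (q - 1) * 'd u0 x h +
              t * (u1 x / s) `^ (q - 1) * 'd u1 x h).
Proof.
move=> Fx0.
have u0x := nbhs_singleton u0_ge0; have u1x := nbhs_singleton u1_ge0.
have d0 := is_diff_powR q1 (differentiableP du0) u0_ge0.
have d1 := is_diff_powR q1 (differentiableP du1) u1_ge0.
have dF := is_diffD (is_diffZ (1 - t) d0) (is_diffZ t d1).
apply: is_diff_eq; first exact: (is_diff_powR_gt0 q^-1 dF Fx0).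
have s0 : 0 < s by exact: powR_gt0.
(* The factor left by differentiating the root is a power of [s]; it turns [u_i^(q-1)] into
   [(u_i / s)^(q-1)]. *)
have FE : F x `^ (q^-1 - 1) = (s `^ (q - 1))^-1.
  rewrite -powRN -powRrM; congr (_ `^ _).
  by field; rewrite gt_eqF.
have divE u : 0 <= u -> (u / s) `^ (q - 1) = u `^ (q - 1) * F x `^ (q^-1 - 1).
  move=> u_ge0; rewrite powRM ?invr_ge0 ?(ltW s0)//.
  by rewrite -[s^-1]powR_inv1 ?(ltW s0)// -powRrM mulN1r powRN FE.
apply/funext => h; rewrite !divE//.
rewrite -[LHS]/(q^-1 * F x `^ (q^-1 - 1) *
  ((1 - t) * (q * u0 x `^ (q - 1) * 'd u0 x h) +
   t * (q * u1 x `^ (q - 1) * 'd u1 x h))).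
by field; rewrite gt_eqF.
Qed.

End SigmaDiff.

(** Differentiability of [sigma] is part of the conclusion because [gradient] is total: it
    guarantees that the left side involves a genuine gradient. *)
Theorem proposition2p6 (R : realType) (N : nat) (p q : R)
    (p_gt1 : 1 < p) (q_gt1 : 1 < q) (q_le_p : q <= p)
    (H : 'rV[R]_N -> R)
    (H_ge0 : forall z, 0 <= H z)
    (H_hom : positively_homogeneous p H)
    (H_convex : convex_function [set: convex_lmodType 'rV[R]_N] H)
    (Omega : set 'rV[R]_N) (Omega_open : open Omega)
    (u0 u1 : 'rV[R]_N -> R)
    (u0_ge0 : forall x, Omega x -> 0 <= u0 x)
    (u1_ge0 : forall x, Omega x -> 0 <= u1 x)
    (u0_diff : forall x, Omega x -> differentiable u0 x)
    (u1_diff : forall x, Omega x -> differentiable u1 x)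
    (t : R) (t_ge0 : 0 <= t) (t_le1 : t <= 1)
    (x : 'rV[R]_N) (x_in : Omega x) :
  differentiable (sigma q u0 u1 t) x /\
  H (gradient (sigma q u0 u1 t) x) <=
    (1 - t) * H (gradient u0 x) + t * H (gradient u1 x).
Proof.
have Omega_near : \forall y \near x, Omega y by exact: open_nbhs_nbhs.
have u0n : \forall y \near x, 0 <= u0 y by apply: filterS Omega_near.
have u1n : \forall y \near x, 0 <= u1 y by apply: filterS Omega_near.
have d0 := u0_diff x x_in; have d1 := u1_diff x x_in.
have u0x := u0_ge0 x x_in; have u1x := u1_ge0 x x_in.
have p_gt0 : 0 < p by apply: lt_trans p_gt1.
have q_gt0 : 0 < q by apply: lt_trans q_gt1.
have t_le1' : 0 <= 1 - t by rewrite subr_ge0.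
set F := (1 - t) * u0 x `^ q + t * u1 x `^ q.
have : 0 <= F by rewrite addr_ge0 ?mulr_ge0 ?powR_ge0.
rewrite le0r => /orP[/eqP F0|F_gt0].
  have ds := is_diff_sigma_eq0 q_gt1 t_ge0 t_le1 u0n u1n d0 d1 F0.
  split => //; rewrite (gradientE ds).
  (* Written as a multiple by [0] so that homogeneity yields [H 0 = 0^p * H 0 = 0]. *)
  have -> : \row_i (0 : 'rV[R]_N -> R) (delta_mx 0 i) = 0 *: (0 : 'rV[R]_N).
    by apply/rowP => i; rewrite !mxE mul0r.
  by rewrite H_hom// powR0 ?gt_eqF// mul0r addr_ge0 ?mulr_ge0.
have ds := is_diff_sigma_gt0 q_gt1 u0n u1n d0 d1 F_gt0.
split => //; rewrite (gradientE ds).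
set s := sigma q u0 u1 t x.
have s_gt0 : 0 < s by exact: powR_gt0.
have sq : s `^ q = F by rewrite -powRrM mulVf ?gt_eqF// powRr1 ?ltW.
pose a0 := u0 x / s; pose a1 := u1 x / s.
have a0_ge0 : 0 <= a0 by rewrite divr_ge0 ?(ltW s_gt0).
have a1_ge0 : 0 <= a1 by rewrite divr_ge0 ?(ltW s_gt0).
(* Chosen so that [b_i = a_i^e] satisfies [b_i^(p-1) = a_i^(q-1)], the coefficient in the gradient
   of [sigma]. *)
pose e := (q - 1) / (p - 1).
have pB1 : 0 < p - 1 by rewrite subr_gt0.
have qB1 : 0 < q - 1 by rewrite subr_gt0.
have e_gt0 : 0 < e by rewrite divr_gt0.
have aB a : (a `^ e) `^ (p - 1) = a `^ (q - 1).
  by rewrite -powRrM divfK// gt_eqF.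
have -> : \row_i ((1 - t) * a0 `^ (q - 1) * 'd u0 x (delta_mx 0 i) +
              t * a1 `^ (q - 1) * 'd u1 x (delta_mx 0 i)) =
   ((1 - t) * (a0 `^ e) `^ (p - 1)) *: gradient u0 x +
   (t * (a1 `^ e) `^ (p - 1)) *: gradient u1 x.
  apply/rowP => i; rewrite !aB (gradientE (differentiableP d0)).
  by rewrite (gradientE (differentiableP d1)) !mxE.
(* The two inequalities below are used with [w = 1 - t], hence [1 - (1 - t)] in place of [t]. *)
have a_sum : (1 - t) * a0 `^ q + (1 - (1 - t)) * a1 `^ q = 1.
  have aq u : 0 <= u -> (u / s) `^ q = u `^ q / F.
    move=> u_ge0; rewrite powRM ?invr_ge0 ?(ltW s_gt0)// -sq.
    by rewrite -[s^-1]powR_inv1 ?(ltW s_gt0)// -powRrM mulN1r powRN.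
  by rewrite !aq// subKr !mulrA -mulrDl divff ?gt_eqF.
have t_ge0' : 1 - t <= 1 by rewrite gerBl.
have ep_le : e * p <= q.
  by rewrite /e mulrAC ler_pdivrMr//; nra.
have ep_gt0 : 0 < e * p by rewrite mulr_gt0.
have := power_mean_bounds ep_gt0 ep_le t_le1' t_ge0' a0_ge0 a1_ge0 a_sum.
rewrite (powRrM a0 e) (powRrM a1 e) => /andP[S_gt0 S_le1].
have := convex_homogeneous_le (gradient u0 x) (gradient u1 x) p_gt1 H_ge0 H_hom
  H_convex t_le1' t_ge0' (powR_ge0 a0 e) (powR_ge0 a1 e) S_gt0 S_le1.
by rewrite subKr.
Qed.
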